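(* Let $d\ge 3$ and let $\Lambda$ be a finite nonempty subset of $\mathbb{Z}^d$. For $z\in\Lambda$ let $q_z=\mathbb{P}_z(H^+_\Lambda<\infty)$, and let $q=\mathbb{P}_0(H^+_{\{0\}}<\infty)$. Then for any family of nonnegative integers $(n_z)_{z\in\Lambda}$, $$\mathbb{P}\big(\ell_\infty(z)\ge n_z\ \text{ for all } z\in\Lambda\big)\le \frac{\prod_{z\in\Lambda}q_z^{\,n_z}}{\min_{z\in\Lambda}q_z}.$$ In particular, for all $t\ge 1$, $$\mathbb{P}\big(\ell_\infty(z)\ge t\ \text{ for all } z\in\Lambda\big)\le \frac1q\,\exp\big(-t\,\mathrm{cap}(\Lambda)\big).$$
   Context: $(S_n)_{n\ge 0}$ is the simple random walk on $\mathbb{Z}^d$, $\mathbb{P}_x$ its law when started at $x$, and $\mathbb{P}=\mathbb{P}_0$. The local time is $\ell_\infty(z)=\sum_{k=0}^\infty\mathbf{1}\{S_k=z\}$ (time $0$ is counted). $H^+_\Lambda=\inf\{n\ge 1:S_n\in\Lambda\}$ is the return time to $\Lambda$, and the capacity of a finite set $\Lambda\subset \mathbb{Z}^d$ is $\mathrm{cap}(\Lambda)=\sum_{x\in\Lambda}\mathbb{P}_x(H^+_\Lambda=\infty)$. *)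

(* Defs.v *)
From HB Require Import structures.
From mathcomp Require Import all_boot all_order all_algebra finmap.
From mathcomp Require Import all_classical all_reals all_analysis.

Set Implicit Arguments.
Unset Strict Implicit.
Unset Printing Implicit Defensive.

Import Order.TTheory GRing.Theory Num.Theory.
Import numFieldNormedType.Exports.

Local Open Scope classical_set_scope.
Local Open Scope ring_scope.

HB.instance Definition _ := isPointed.Build int 0.

Section lattice.
Variable d : nat.

HB.instance Definition _ := @isMeasurable.Build default_measure_display
  'rV[int]_d discrete_measurable discrete_measurable0
  discrete_measurableC discrete_measurableU.

Definition unit_step (e : 'rV[int]_d) : bool :=
  [exists i, (e == delta_mx 0 i) || (e == - delta_mx 0 i)].

End lattice.

Definition independent_family (d d' : measure_display) (T : measurableType d)
    (U : measurableType d') (R : realType) (P : probability T R)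
    (X : nat -> T -> U) : Prop :=
  forall (I : {fset nat}) (A : nat -> set U),
    (forall k, k \in I -> measurable (A k)) ->
    P (\bigcap_(k in [set` I]) (X k @^-1` A k)) =
    (\prod_(k <- I) P (X k @^-1` A k))%E.

Section random_walk.
Variables (disp : measure_display) (T : measurableType disp) (R : realType).
Variable d : nat.
Implicit Types (P : probability T R) (S : nat -> {mfun T >-> 'rV[int]_d}).
Implicit Types (x z : 'rV[int]_d) (L : {fset 'rV[int]_d}).

Definition increment S (k : nat) (w : T) : 'rV[int]_d := S k.+1 w - S k w.

(* S is a simple random walk started at x under the law P.  The start is only
   almost sure, so that a single process S can carry the laws P_x of all
   starting points x. *)
Record simple_random_walk P S x : Prop := {
  srw_start : P [set w | S 0%N w = x] = 1%E ;
  srw_step : forall k e,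
    P [set w | increment S k w = e] =
    (if unit_step e then (2 * d)%:R^-1 else 0)%:E ;
  srw_indep : independent_family P (increment S) }.

Definition local_time S z (w : T) : \bar R :=
  (\sum_(0 <= k <oo) (\1_[set z] (S k w))%:E)%E.

(* H^+_L, with value +oo (the infimum of the empty set) if there is no return *)
Definition return_time S L (w : T) : \bar R :=
  ereal_inf [set n%:R%:E | n in [set n : nat | (1 <= n)%N /\ S n w \in L]].

(* Below, P is the family of laws: P x is the law of the walk started at x. *)

Definition return_prob (P : 'rV[int]_d -> probability T R) S L x : R :=
  fine (P x [set w | (return_time S L w < +oo)%E]).

Definition escape_prob (P : 'rV[int]_d -> probability T R) S L x : R :=
  fine (P x [set w | return_time S L w = +oo%E]).

Definition capacity (P : 'rV[int]_d -> probability T R) S L : R :=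
  \sum_(x <- L) escape_prob P S L x.

End random_walk.

(* The minimum of f over L, for nonempty L: the seed of the iterated minimum
   is itself one of the values, so it does not affect the result. *)
Definition fset_min (K : choiceType) (R : realType) (x0 : K) (L : {fset K})
    (f : K -> R) : R :=
  \big[Num.min/f (head x0 L)]_(z <- L) f z.

(* Main.v *)
(* Let h(x) be the probability of returning to L from x, so that
   h(x) = E_x[a(S_1)] with a = 1 on L and a = h off L.  For a requirement n on
   the numbers of visits to the points of L, not identically zero on L, the
   probability that the walk started at x meets n during the times 1, .., m is
   at most h(x) * prod_z q_z ^ n_z / min q.  This follows by induction on m,
   conditioning on S_1 = y: if y is in L and n_y > 0, the requirement n_y
   decreases by one, and the factor q_y lost from the product is h(y); if
   nothing remains to be visited, q_y >= min q suffices.  The start at 0 is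
   treated as such a step, and m tends to infinity.  The second bound uses
   1 - u <= exp(-u) and q_z >= P_z(the walk returns to z) = q. *)
Require Import Defs.
From HB Require Import structures.
From mathcomp Require Import all_boot all_order all_algebra finmap.
From mathcomp Require Import all_classical all_reals all_analysis.

Set Implicit Arguments.
Unset Strict Implicit.
Unset Printing Implicit Defensive.

Import Order.TTheory GRing.Theory Num.Theory.
Import numFieldNormedType.Exports.

Local Open Scope classical_set_scope.
Local Open Scope ring_scope.

(** * Unit steps of the lattice and averages over finite paths *)

Section steps.
Variable d : nat.
Local Notation V := 'rV[int]_d.

(** [undup] makes the list duplicate-free by construction, so sums over it count each step once. *)
Definition unit_steps : seq V :=
  undup ([seq delta_mx 0 i | i <- enum 'I_d] ++
         [seq - delta_mx 0 i | i <- enum 'I_d]).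

Lemma uniq_unit_steps : uniq unit_steps.
Proof. exact: undup_uniq. Qed.

Lemma mem_unit_steps e : (e \in unit_steps) = unit_step e.
Proof.
rewrite mem_undup mem_cat; apply/orP/existsP.
  by case=> /mapP[i _ ->]; exists i; rewrite eqxx ?orbT.
by case=> i /orP[] /eqP ->; [left|right]; apply: map_f; rewrite mem_enum.
Qed.

End steps.

Section walk_mean.
Variables (R : realType) (d : nat).
Local Notation V := 'rV[int]_d.

(* The mean of F (S_1, .., S_m) for the walk started at x. *)
Fixpoint walk_mean (m : nat) (x : V) (F : seq V -> R) : R :=
  if m is m'.+1 then
    (2 * d)%:R^-1 * \sum_(e <- unit_steps d)
       walk_mean m' (x + e) (fun s => F (x + e :: s))
  else F [::].

Lemma eq_walk_mean m x F G : F =1 G -> walk_mean m x F = walk_mean m x G.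
Proof.
elim: m x F G => [|m IH] x F G FG /=; first exact: FG.
by congr (_ * _); apply: eq_bigr => e _; apply: IH => s; apply: FG.
Qed.

Lemma le_walk_mean m x F G :
  (forall s, F s <= G s) -> walk_mean m x F <= walk_mean m x G.
Proof.
elim: m x F G => [|m IH] x F G FG /=; first exact: FG.
rewrite ler_wpM2l ?invr_ge0 ?ler0n//.
by apply: ler_sum => e _; apply: IH => s; apply: FG.
Qed.

Lemma walk_mean_shift m x y F :
  walk_mean m (x + y) F = walk_mean m x (fun s => F [seq z + y | z <- s]).
Proof.
elim: m x F => [//|m IH] x F /=.
congr (_ * _); apply: eq_bigr => e _.
by rewrite addrAC IH.
Qed.

End walk_mean.

(** * The law of finite segments of the walk *)

Lemma probability1_setIr (disp : measure_display) (T : measurableType disp)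
    (R : realType) (P : probability T R) (A B : set T) :
  measurable A -> measurable B -> P A = 1%E -> P (A `&` B) = P B.
Proof.
move=> mA mB PA.
have PAC : P (~` A) = 0%E by rewrite probability_setC// PA subee.
rewrite [RHS](_ : _ = P (B `&` A) + P (B `&` ~` A))%E; last first.
  by rewrite -setDE addeC; apply: measureDI.
rewrite [X in (_ + X)%E](_ : _ = 0%E) ?adde0 1?setIC//.
apply/eqP; rewrite eq_le measure_ge0 andbT -PAC.
have mAC : measurable (~` A) by exact: measurableC.
by apply: le_measure; rewrite ?inE//; exact: measurableI.
Qed.

Section law.
Variables (disp : measure_display) (T : measurableType disp) (R : realType).
Variables (d : nat) (S : nat -> {mfun T >-> 'rV[int]_d}).
Local Notation V := 'rV[int]_d.

Definition walk_segment (j k : nat) (w : T) : seq V :=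
  [seq S i w | i <- iota j k].

(** The lattice is countable and discrete: splitting on the value of [S j] gives a countable union,
    so no condition on [A] is required. *)
Lemma measurable_walk_segment j k (A : set (seq V)) :
  measurable [set w | A (walk_segment j k w)].
Proof.
elim: k j A => [|k IH] j A.
  have [A0|A0] := pselect (A [::]).
    by rewrite [X in measurable X](_ : _ = setT)//; apply/seteqP; split.
  by rewrite [X in measurable X](_ : _ = set0)//; apply/seteqP; split.
rewrite [X in measurable X](_ : _ = \bigcup_(v : V)
   ([set w | S j w = v] `&` [set w | A (v :: walk_segment j.+1 k w)])).
  apply: countable_bigcupT_measurable; first exact: countableP.
  move=> v; apply: measurableI; last exact: (IH j.+1 (fun s => A (v :: s))).
  rewrite -[X in measurable X]setTI.
  by apply: (@measurable_funP _ _ _ _ _ (S j) measurableT [set v]).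
apply/seteqP; split=> [w /= Aw|w [v _ /= [<-]//]].
by exists (S j w).
Qed.

Variables (P : probability T R) (x : V) (hS : simple_random_walk P S x).

Definition step_weight (e : V) : R := if unit_step e then (2 * d)%:R^-1 else 0.

Lemma measurable_increment k (A : set V) :
  measurable [set w | A (increment S k w)].
Proof.
exact: (measurable_walk_segment k 2 (fun s => A (nth 0 s 1 - nth 0 s 0))).
Qed.

(** The law of an increment is known only pointwise. Countability turns this into the statement that
    almost surely the increment is a unit step, after which only a finite sum remains. *)
Lemma probability_split_increment k (A : set T) : measurable A ->
  P A = (\sum_(e <- unit_steps d) P (A `&` [set w | increment S k w = e]))%E.
Proof.
move=> mA.
have mI e : measurable [set w | increment S k w = e].
  exact: (measurable_increment k [set e]).
pose U (s : seq V) := [set w | increment S k w \in s].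
have mU s : measurable (U s) by exact: (measurable_increment k [set` s]).
have sum_U s : uniq s ->
    P (A `&` U s) =
    (\sum_(e <- s) P (A `&` [set w | increment S k w = e]))%E.
  elim: s => [_|e s IH /= /andP[es us]].
    rewrite big_nil [X in P X](_ : _ = set0) ?measure0//.
    by apply/seteqP; split=> w //= [].
  rewrite big_cons -IH//.
  rewrite -measureU; first last.
  - apply/seteqP; split=> // w /= [[_ ew] [_ Uw]].
    by move: es; rewrite -ew => /negP; apply.
  - exact: measurableI.
  - exact: measurableI.
  congr (P _); rewrite -setIUr; congr (_ `&` _).
  apply/seteqP; split=> w /=; rewrite /U /= inE.
    by case/orP=> [/eqP|]; [left|right].
  by case=> [->|->]; rewrite ?eqxx ?orbT.
rewrite -sum_U ?uniq_unit_steps//.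
have U0 : P (~` U (unit_steps d)) = 0%E.
  apply/negligibleP; first exact: measurableC.
  (* Enumerating the lattice by [unpickle] covers the event of a forbidden increment by countably
     many null events. *)
  pose N n : set T := if (choice.unpickle n : option V) is Some e then
    if unit_step e then set0 else [set w | increment S k w = e] else set0.
  apply: (@negligibleS _ _ _ _ (\bigcup_n N n)).
    move=> w /= /negP; rewrite mem_unit_steps => /negbTE uw.
    by exists (choice.pickle (increment S k w)); rewrite /N ?choice.pickleK ?uw.
  apply: negligible_bigcup => n; rewrite /N.
  case: choice.unpickle => [e|]; last exact: negligible_set0.
  case: ifPn => ue; first exact: negligible_set0.
  apply/negligibleP; first exact: mI.
  by have := srw_step hS k e; rewrite (negbTE ue).
rewrite setIC probability1_setIr//.
rewrite -[X in P X]setCK probability_setC ?U0 ?sube0//.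
exact: measurableC.
Qed.

Definition path_weight (s : seq V) : R :=
  \prod_(e <- pairmap (fun a b => b - a) x s) step_weight e.

(** A path is determined by its start, which is almost surely [x], and its increments; independence
    turns the prescribed increments into a product. *)
Lemma walk_path_probability s :
  P [set w | walk_segment 0 (size s).+1 w = x :: s] = (path_weight s)%:E.
Proof.
pose ds := pairmap (fun a b : V => b - a) x s.
pose B := \bigcap_(k in [set` [fset k in iota 0 (size s)]%fset])
   (increment S k @^-1` [set nth 0 ds k]).
have mB : measurable B.
  apply: fin_bigcap_measurable => [|k _]; first exact: finite_fset.
  exact: (measurable_increment k [set nth 0 ds k]).
have -> : [set w | walk_segment 0 (size s).+1 w = x :: s] =
    [set w | S 0%N w = x] `&` B.
  apply/seteqP; split => [w /= [S0 Ss]|w [/= S0 Bw]].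
    split=> // k /=; rewrite !inE mem_iota add0n /= => ks.
    rewrite (nth_pairmap 0)// /increment.
    have nthE i : (i <= size s)%N -> nth 0 (x :: s) i = S i w.
      case: i => [//|i] si /=.
      rewrite -[in nth _ _ _]Ss (nth_map 0%N) ?size_iota//.
      by rewrite nth_iota.
    by rewrite nthE 1?ltnW// -[nth 0 s k]/(nth 0 (x :: s) k.+1) nthE.
  rewrite /walk_segment /= S0; congr (_ :: _).
  apply: (@eq_from_nth _ 0) => [|i]; rewrite size_map size_iota// => si.
  rewrite (nth_map 0%N) ?size_iota// nth_iota// add1n.
  (* Conversely, the positions are recovered one at a time by adding each increment to the previous
     position. *)
  elim: i si => [|i IH] si.
    have /= := Bw 0%N; rewrite !inE mem_iota /= => /(_ si).
    rewrite (nth_pairmap 0)// /increment /= S0 => /(congr1 (+%R^~ x)).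
    by rewrite !subrK.
  have /= := Bw i.+1; rewrite !inE mem_iota /= => /(_ si).
  rewrite (nth_pairmap 0)// /increment /= IH 1?ltnW//.
  by move=> /(congr1 (+%R^~ (nth 0 s i))); rewrite !subrK.
rewrite probability1_setIr//; last 2 first.
- exact: (measurable_walk_segment 0 1 (fun s => nth 0 s 0 = x)).
- exact: srw_start hS.
rewrite (srw_indep hS)//.
rewrite (perm_big (iota 0 (size s))) /=; last first.
  apply: uniq_perm => [||k]; rewrite ?fset_uniq ?iota_uniq//.
  by rewrite !inE.
rewrite (eq_bigr (fun k => (step_weight (nth 0 ds k))%:E)); last first.
  by move=> k _; apply: (srw_step hS).
rewrite /path_weight [in RHS](big_nth 0) size_pairmap -/ds prodEFin.
by rewrite /index_iota subn0.
Qed.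

(** This is the Markov property: once the path up to time [size s] is fixed, the future is averaged
    as for a walk started at its endpoint. The induction on [m] moves the next position into the
    fixed prefix, which is why [s] is arbitrary. *)
Lemma walk_path_mean s m (Q : pred (seq V)) :
  P [set w | walk_segment 0 (size s).+1 w = x :: s /\
             Q (walk_segment (size s).+1 m w)] =
  (path_weight s * walk_mean m (last x s) (fun r => (Q r)%:R : R))%:E.
Proof.
elim: m s Q => [|m IH] s Q /=.
  have [Q0|Q0] := boolP (Q [::]).
    rewrite mulr1 -walk_path_probability; congr (P _).
    by apply/seteqP; split => w //= [].
  rewrite mulr0 [X in P X](_ : _ = set0) ?measure0//.
  by apply/seteqP; split => w //= [].
set A := (X in P X).
have mA : measurable A.
  have -> : A = [set w | walk_segment 0 (size s).+1 w = x :: s] `&`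
     [set w | Q (walk_segment (size s).+1 m.+1 w)] by [].
  apply: measurableI.
    exact: (measurable_walk_segment 0 (size s).+1 [set x :: s]).
  exact: (measurable_walk_segment (size s).+1 m.+1 Q).
rewrite (probability_split_increment (size s) mA).
rewrite mulrA mulr_sumr -sumEFin; apply: eq_big_seq => e.
rewrite mem_unit_steps => ue.
pose y := last x s + e.
have -> : A `&` [set w | increment S (size s) w = e] =
  [set w | walk_segment 0 (size (rcons s y)).+1 w = x :: rcons s y /\
    Q (y :: walk_segment (size (rcons s y)).+1 m w)].
  (* The prefix grows at its right end, whereas [iota] unfolds at its left end. *)
  have iotaE : iota 0 (size s).+2 = rcons (iota 0 (size s).+1) (size s).+1.
    by rewrite -cats1 -[(size s).+2]addn1 iotaD.
  rewrite size_rcons /A /walk_segment iotaE; apply/seteqP.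
  have lastE w : [seq S i w | i <- iota 0 (size s).+1] = x :: s ->
      S (size s) w = last x s.
    move=> /(congr1 (fun r => nth 0 r (size s))).
    rewrite (nth_map 0%N) ?size_iota// nth_iota// add0n => ->.
    by rewrite (last_nth 0).
  split=> w; rewrite /mkset map_rcons -rcons_cons.
    move=> [[Ss QS]]; rewrite /mkset /increment => Se.
    have Sy : S (size s).+1 w = y.
      by rewrite /y -Se -(lastE _ Ss) addrC subrK.
    by split; [rewrite -Ss Sy| rewrite -Sy].
  move=> [/rcons_inj[S0 Ss Sy] QS].
  have Ss' : [seq S i w | i <- iota 0 (size s).+1] = x :: s by rewrite /= S0 Ss.
  split=> /=; first by split => //; rewrite Sy.
  by rewrite /increment Sy (lastE _ Ss') /y addrC addKr.
rewrite (IH (rcons s y) (fun r => Q (y :: r))) last_rcons; congr (_ * _)%:E.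
rewrite /path_weight -cats1 pairmap_cat big_cat /= big_seq1; congr (_ * _).
by rewrite /step_weight /y addrC addKr ue.
Qed.

Lemma walk_mean_probability0 m (Q : pred (seq V)) :
  P [set w | Q (walk_segment 0 m.+1 w)] =
  (walk_mean m x (fun r => (Q (x :: r))%:R : R))%:E.
Proof.
have := walk_path_mean [::] m (fun r => Q (x :: r)).
rewrite /path_weight /= big_nil mul1r => <-.
rewrite -(@probability1_setIr _ _ _ _ [set w | S 0%N w = x])//.
- congr (P _); apply/seteqP; rewrite /walk_segment; split=> w /=.
    by case=> S0; rewrite /= S0.
  by case=> -[S0]; rewrite /= S0.
- exact: (measurable_walk_segment 0 1 (fun s => nth 0 s 0 = x)).
- exact: (measurable_walk_segment 0 m.+1 Q).
- exact: srw_start hS.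
Qed.

Lemma walk_mean_probability m (Q : pred (seq V)) :
  P [set w | Q (walk_segment 1 m w)] =
  (walk_mean m x (fun r => (Q r)%:R : R))%:E.
Proof. exact: (walk_mean_probability0 m (fun r => Q (behead r))). Qed.

(** The total mass is read off from the probability of the whole space, which avoids counting the
    unit steps. *)
Lemma walk_mean1 m : walk_mean m x (fun=> 1 : R) = 1.
Proof.
have := walk_mean_probability m predT.
rewrite [X in P X](_ : _ = setT); last by apply/seteqP; split.
by rewrite probability_setT => -[].
Qed.

End law.

(** * Return probabilities: truncation, first-step equation, comparison *)

Section hitting.
Variables (disp : measure_display) (T : measurableType disp) (R : realType).
Variables (d : nat) (S : nat -> {mfun T >-> 'rV[int]_d}).
Variable P : 'rV[int]_d -> probability T R.
Hypothesis hS : forall x, simple_random_walk (P x) S x.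
Local Notation V := 'rV[int]_d.

Local Notation hits L := (has (fun y : V => y \in L)).

(** The probability of a return by time [m]; time 0 does not count, as in [return_time]. *)
Definition return_mean (L : {fset V}) (m : nat) (x : V) : R :=
  walk_mean m x (fun s => (hits L s)%:R).

Lemma return_time_ltey (L : {fset V}) :
  [set w | (return_time R S L w < +oo)%E] =
  \bigcup_m [set w | hits L (walk_segment S 1 m w)].
Proof.
apply/seteqP; split => w /=.
  move=> /ereal_inf_lt[_ [n [n1 Sn] <-] _]; exists n => //=.
  apply/hasP; exists (S n w) => //; apply/map_f.
  by rewrite mem_iota n1 add1n /=.
case=> m _ /hasP[_ /mapP[n + ->] Sn]; rewrite mem_iota => /andP[n1 _].
apply: (@le_lt_trans _ _ (n%:R%:E)%E); last by rewrite ltry.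
by apply: ereal_inf_lbound; exists n.
Qed.

Lemma measurable_return (L : {fset V}) :
  measurable [set w | (return_time R S L w < +oo)%E].
Proof.
rewrite return_time_ltey; apply: bigcup_measurable => m _.
exact: (measurable_walk_segment S 1 m (hits L)).
Qed.

Lemma return_probE L x :
  P x [set w | (return_time R S L w < +oo)%E] = (return_prob P S L x)%:E.
Proof. by rewrite fineK// fin_num_measure//; exact: measurable_return. Qed.

Lemma return_prob_le1 L x : return_prob P S L x <= 1.
Proof.
by rewrite -lee_fin -return_probE probability_le1//; exact: measurable_return.
Qed.

Lemma escape_probE L x : escape_prob P S L x = 1 - return_prob P S L x.
Proof.
apply: EFin_inj; rewrite EFinB -return_probE -probability_setC; last first.
  exact: measurable_return.
have -> : ~` [set w | (return_time R S L w < +oo)%E] =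
    [set w | return_time R S L w = +oo%E].
  apply/seteqP; split=> w /=; rewrite ltey; first by move=> /negP/negPn/eqP.
  by move=> ->; rewrite eqxx.
rewrite /escape_prob fineK// fin_num_measure//.
have -> : [set w | return_time R S L w = +oo%E] =
    ~` [set w | (return_time R S L w < +oo)%E].
  apply/seteqP; split=> w /=; rewrite ltey; last by move=> /negP/negPn/eqP.
  by move=> ->; rewrite eqxx.
by apply: measurableC; exact: measurable_return.
Qed.

(** The events of a return by time [m] increase to the event of a return, so continuity from below
    applies. *)
Lemma return_mean_cvg L x :
  return_mean L m x @[m --> \oo] --> return_prob P S L x.
Proof.
have -> : return_mean L ^~ x =
    fine \o (fun m => P x [set w | hits L (walk_segment S 1 m w)]).
  by apply/funext => m /=; rewrite (walk_mean_probability (hS x) m (hits L)).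
apply: fine_cvg; rewrite -return_probE return_time_ltey.
apply: nondecreasing_cvg_mu => [m||m n mn].
- exact: (measurable_walk_segment S 1 m (hits L)).
- by rewrite -return_time_ltey; exact: measurable_return.
- apply/subsetPset => w /=.
  by rewrite /walk_segment -(subnKC mn) iotaD map_cat has_cat => ->.
Qed.

Lemma return_mean_le L m x : return_mean L m x <= return_prob P S L x.
Proof.
rewrite -lee_fin -return_probE -(walk_mean_probability (hS x) m (hits L)).
apply: le_measure; rewrite ?inE.
- exact: (measurable_walk_segment S 1 m (hits L)).
- exact: measurable_return.
- by rewrite return_time_ltey => w /= hw; exists m.
Qed.

Lemma return_prob_ge0 L x : 0 <= return_prob P S L x.
Proof. by apply: le_trans (return_mean_le L 0 x); rewrite /return_mean. Qed.

(** First-step analysis is immediate for the truncated probabilities, relating horizon [m.+1] to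
    horizon [m]; it passes to the limit because the sum over steps is finite. *)
Lemma return_prob_step L x :
  return_prob P S L x = (2 * d)%:R^-1 * \sum_(e <- unit_steps d)
    (if x + e \in L then 1 else return_prob P S L (x + e)).
Proof.
have stepE m : return_mean L m.+1 x = (2 * d)%:R^-1 * \sum_(e <- unit_steps d)
    (if x + e \in L then 1 else return_mean L m (x + e)).
  rewrite /return_mean [LHS]/=; congr (_ * _); apply: eq_bigr => e _.
  by case: ifP => // _; apply: walk_mean1 (hS (x + e)) m.
have := return_mean_cvg (L := L) (x := x); rewrite -cvg_shiftS => retS.
apply: (cvg_unique _ retS) => //.
rewrite (_ : [sequence _]_n = fun m => (2 * d)%:R^-1 * \sum_(e <- unit_steps d)
    (if x + e \in L then 1 else return_mean L m (x + e))); last first.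
  by apply/funext => m; exact: stepE.
apply: cvgMl_tmp; apply: cvg_big => [|e _]; first exact: add_continuous.
by case: ifP => _; [exact: cvg_cst | exact: return_mean_cvg].
Qed.

Lemma return_prob_shift z :
  return_prob P S [fset z]%fset z = return_prob P S [fset 0]%fset 0.
Proof.
apply: (cvg_unique _ (return_mean_cvg (L := [fset z]%fset) (x := z))) => //.
rewrite (_ : return_mean _ ^~ z = return_mean [fset 0]%fset ^~ 0).
  exact: return_mean_cvg.
apply/funext => m.
have := walk_mean_shift m 0 z (fun s => (hits [fset z]%fset s)%:R : R).
rewrite add0r => zE; rewrite /return_mean zE; apply: eq_walk_mean => s.
congr (nat_of_bool _)%:R; rewrite has_map.
by apply: eq_has => y /=; rewrite !inE -[X in _ == X]add0r (inj_eq (addIr z)).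
Qed.

Lemma sub_return_prob (L L' : {fset V}) x : {subset L <= L'} ->
  return_prob P S L x <= return_prob P S L' x.
Proof.
move=> LL'; apply: (ler_cvg_to (return_mean_cvg (L := L) (x := x))
  (return_mean_cvg (L := L') (x := x))).
apply: nearW => m; apply: le_walk_mean => s; rewrite ler_nat.
have [/hasP[y ys yL]|//] := boolP (hits L s).
by rewrite lt0b; apply/hasP; exists y => //; exact: LL'.
Qed.

(** The two-step path along a unit vector [e] and back has positive weight and returns to 0 at time
    2. *)
Lemma return_prob_gt0 (d_gt0 : (0 < d)%N) : 0 < return_prob P S [fset 0]%fset 0.
Proof.
have p_gt0 : 0 < (2 * d)%:R^-1 :> R by rewrite invr_gt0 ltr0n muln_gt0.
apply: lt_le_trans (return_mean_le _ 2 _).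
pose i := Ordinal d_gt0; pose e : V := delta_mx 0 i.
have eU : e \in unit_steps d.
  by rewrite mem_unit_steps; apply/existsP; exists i; rewrite eqxx.
have NeU : - e \in unit_steps d.
  by rewrite mem_unit_steps; apply/existsP; exists i; rewrite eqxx orbT.
rewrite /return_mean /= pmulr_rgt0//.
rewrite (bigD1_seq e) ?uniq_unit_steps//= ltr_pwDl//; last first.
  apply: sumr_ge0 => f _; rewrite mulr_ge0 ?(ltW p_gt0)//.
  exact: sumr_ge0.
rewrite pmulr_rgt0// (bigD1_seq (- e)) ?uniq_unit_steps//= ltr_pwDl//.
  by rewrite add0r subrr !inE eqxx orbT.
exact: sumr_ge0.
Qed.

End hitting.

(** * Prescribed numbers of visits and local times *)

Section visits.
Variables (disp : measure_display) (T : measurableType disp) (R : realType).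
Variables (d : nat) (S : nat -> {mfun T >-> 'rV[int]_d}).
Variable P : 'rV[int]_d -> probability T R.
Hypothesis hS : forall x, simple_random_walk (P x) S x.
Local Notation V := 'rV[int]_d.
Variable L : {fset V}.
Local Notation q := (return_prob P S L).

Definition visited (n : V -> nat) (s : seq V) : bool :=
  all (fun z => (n z <= count_mem z s)%N) L.

(** Subtraction on [nat] truncates at 0, so a visit to a point where nothing is due leaves the
    requirement unchanged. *)
Lemma visited_cons n y s :
  visited n (y :: s) = visited (fun z => n z - (y == z))%N s.
Proof. by apply: eq_all => z /=; rewrite leq_subLR. Qed.

Variables (c : R) (c_gt0 : 0 < c) (c_le : forall z, z \in L -> c <= q z).

(** The constant [c] is left free to serve both bounds: it will be the minimum of the return
    probabilities over [L] in the first, and the return probability of the origin in the second. *)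
Definition return_weight (n : V -> nat) : R := (\prod_(z <- L) q z ^+ n z) / c.

Lemma return_weight_ge0 n : 0 <= return_weight n.
Proof.
rewrite mulr_ge0 ?invr_ge0 ?(ltW c_gt0)//.
by apply: prodr_ge0 => z _; rewrite exprn_ge0// return_prob_ge0.
Qed.

Lemma return_weight_sub n y : y \in L -> (0 < n y)%N ->
  return_weight n = q y * return_weight (fun z => n z - (y == z))%N.
Proof.
move=> yL ny; rewrite /return_weight mulrA; congr (_ / _).
rewrite !(bigD1_seq y yL (fset_uniq L)) /= mulrA eqxx subn1 -exprS prednK//.
congr (_ * _); apply: eq_bigr => z zy.
by rewrite eq_sym (negbTE zy) subn0.
Qed.

Lemma return_weight0 n : (forall z, z \in L -> n z = 0%N) ->
  return_weight n = c^-1.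
Proof.
by move=> n0; rewrite /return_weight big1_seq ?mul1r// => z /andP[_ /n0 ->].
Qed.

Lemma eq_return_weight n n' : {in L, n =1 n'} ->
  return_weight n = return_weight n'.
Proof.
by move=> nn'; congr (_ / _); apply: eq_big_seq => z /nn' ->.
Qed.

Definition somewhere_gt0 (n : V -> nat) : bool := has (fun z => (0 < n z)%N) L.

Lemma somewhere_gt0PN n : ~~ somewhere_gt0 n -> forall z, z \in L -> n z = 0%N.
Proof.
move=> /hasPn n0 z zL; apply/eqP; rewrite -leqn0 leqNgt; exact: n0 zL.
Qed.

(* The weight [return_weight n] absorbs one factor [q y] at a visit to [y]; if
   that was the last required visit, [c <= q y] pays for it. *)
Lemma visited_cons_mean m y :
  (forall n, somewhere_gt0 n ->
    walk_mean m y (fun s => (visited n s)%:R : R) <= q y * return_weight n) ->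
  forall n, somewhere_gt0 n ->
    walk_mean m y (fun s => (visited n (y :: s))%:R : R) <=
    (if y \in L then 1 else q y) * return_weight n.
Proof.
move=> IH n n_gt0; pose n' z := (n z - (y == z))%N.
rewrite (eq_walk_mean _ _ (G := fun s => (visited n' s)%:R)); last first.
  by move=> s; rewrite visited_cons.
have n'_id : (y \in L -> n y = 0%N) -> {in L, n' =1 n}.
  move=> ny z zL; rewrite /n'; case: eqP => [yz|_]; last by rewrite subn0.
  by rewrite -yz in zL *; rewrite ny.
(* This covers a position [y] outside [L] as well as one in [L] where no visit is due. *)
have bound_id : {in L, n' =1 n} ->
    walk_mean m y (fun s => (visited n' s)%:R : R) <= q y * return_weight n.
  move=> n'E; rewrite -(eq_return_weight n'E); apply: IH.
  by have /hasP[z zL nz] := n_gt0; apply/hasP; exists z; rewrite ?n'E.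
have [yL|yL] := boolP (y \in L); last first.
  by apply/bound_id/n'_id => yL'; rewrite yL' in yL.
rewrite mul1r; have [ny|ny] := posnP (n y).
  apply: le_trans (bound_id (n'_id _)) _ => //.
  by rewrite ler_piMl ?return_weight_ge0// return_prob_le1.
rewrite (return_weight_sub yL ny).
have [n'_gt0|/somewhere_gt0PN n'0] := boolP (somewhere_gt0 n').
  exact: IH.
rewrite (return_weight0 n'0).
apply: (@le_trans _ _ 1); last by rewrite ler_pdivlMr// mul1r c_le.
rewrite -[leRHS](walk_mean1 (hS y) m); apply: le_walk_mean => s.
by case: visited.
Qed.

(** At horizon 0 a nonzero requirement fails, so the mean vanishes. The inductive step compares with
    [return_prob_step] term by term, over the first step. *)
Lemma visited_mean m x n : somewhere_gt0 n ->
  walk_mean m x (fun s => (visited n s)%:R : R) <= q x * return_weight n.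
Proof.
elim: m x n => [|m IH] x n n_gt0 /=.
  have /hasP[z zL nz] := n_gt0.
  rewrite [visited _ _](_ : _ = false); last first.
    by apply/allPn; exists z; rewrite // -ltnNge.
  by rewrite mulr_ge0 ?return_weight_ge0 ?return_prob_ge0.
rewrite (return_prob_step hS) -mulrA ler_wpM2l ?invr_ge0// mulr_suml.
by apply: ler_sum => e _; apply: visited_cons_mean => // n' /IH.
Qed.

(** The zero requirement lies outside the induction, but its weight is [c^-1], which is at least 1
    because [c] is below some return probability. *)
Lemma visited_probability m n : L != fset0 ->
  (P 0 [set w | visited n (walk_segment S 0 m.+1 w)] <= (return_weight n)%:E)%E.
Proof.
move=> /fset0Pn[y yL].
rewrite (walk_mean_probability0 (hS 0) m (visited n)) lee_fin.
have [n_gt0|/somewhere_gt0PN n0] := boolP (somewhere_gt0 n).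
  apply: le_trans (visited_cons_mean _ n_gt0) _.
    by move=> n' n'_gt0; exact: visited_mean.
  by case: ifP; rewrite ?mul1r// ler_piMl ?return_weight_ge0// return_prob_le1.
rewrite (return_weight0 n0); apply: (@le_trans _ _ 1).
  rewrite -[leRHS](walk_mean1 (hS 0) m); apply: le_walk_mean => s.
  by case: visited.
by rewrite invf_ge1// (le_trans (c_le yL))// return_prob_le1.
Qed.

(* [n] is the ceiling of the level [t]. *)
Lemma local_time_geP (t : R) (n : nat) z w :
  (forall k : nat, (t <= k%:R) = (n <= k)%N) ->
  (t%:E <= local_time R S z w)%E <->
  exists m, (n <= count_mem z (walk_segment S 0 m w))%N.
Proof.
move=> tn.
have ge0 k : (0%N <= k)%N -> xpredT k ->
    (0%:E <= (\1_[set z] (S k w))%:E :> \bar R)%E.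
  by rewrite lee_fin.
have sumE m : (\sum_(0 <= k < m) (\1_[set z] (S k w))%:E)%E =
    (count_mem z (walk_segment S 0 m w))%:R%:E :> \bar R.
  elim: m => [|m IH]; first by rewrite big_nil.
  rewrite big_nat_recr// IH /walk_segment -(addn1 m) iotaD map_cat count_cat.
  rewrite add0n.
  rewrite /= addn0 natrD EFinD; congr (_ + _%:E)%E.
  rewrite indicE; congr (nat_of_bool _)%:R.
  by apply/idP/eqP; rewrite inE.
split=> [tl|[m nm]]; last first.
  apply: (@le_trans _ _ (count_mem z (walk_segment S 0 m w))%:R%:E).
    by rewrite lee_fin tn.
  by rewrite -sumE; exact: nneseries_lim_ge.
apply: contrapT => /forallNP nN.
case: n tn nN => [|n] tn nN; first by case: (nN 0%N).
(* The partial counts are integers below [n.+1], hence at most [n]. This non-strict bound survives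
   in the limit and contradicts the level [t]. *)
have : (local_time R S z w <= n%:R%:E)%E.
  apply: lime_le; first exact: is_cvg_nneseries.
  apply: nearW => m; rewrite sumE lee_fin ler_nat.
  by have /negP := nN m; rewrite -ltnNge ltnS.
by move=> /(le_trans tl); rewrite lee_fin tn ltnn.
Qed.

(** Since [L] is finite, all levels are reached by a common finite time. The event is thus an
    increasing union of finite-horizon events, each with the same bound. *)
Lemma local_times_probability (t : V -> R) (n : V -> nat) : L != fset0 ->
  (forall z (k : nat), (t z <= k%:R) = (n z <= k)%N) ->
  (P 0 [set w | forall z, z \in L -> ((t z)%:E <= local_time R S z w)%E]
   <= (return_weight n)%:E)%E.
Proof.
move=> L0 tn.
have mono m m' w : (m <= m')%N ->
    visited n (walk_segment S 0 m w) -> visited n (walk_segment S 0 m' w).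
  move=> mm' /allP vm; apply/allP => z /vm /leq_trans; apply.
  by rewrite /walk_segment -(subnKC mm') iotaD map_cat count_cat leq_addr.
pose E m := [set w | visited n (walk_segment S 0 m.+1 w)].
have mE m : measurable (E m).
  exact: (measurable_walk_segment S 0 m.+1 (visited n)).
rewrite [X in P 0 X](_ : _ = \bigcup_m E m); last first.
  apply/seteqP; split => w /= => [tw|[m _ /allP vm] z zL]; last first.
    by apply/(local_time_geP _ _ (tn z)); exists m.+1; exact: vm.
  have /choice[f fP] : forall z, exists m, z \in L ->
      (n z <= count_mem z (walk_segment S 0 m w))%N.
    move=> z; have [zL|zL] := boolP (z \in L); last by exists 0%N.
    by have /(local_time_geP _ _ (tn z))[m nm] := tw z zL; exists m.
  (* The largest of the individual times works for all points; [E m] looks at [m.+1] positions,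
     hence the successor below. *)
  exists (\max_(z <- L) f z) => //; apply/allP => z zL.
  apply: leq_trans (fP z zL) _.
  have fm : (f z <= (\max_(z <- L) f z).+1)%N.
    by apply: leqW; exact: leq_bigmax_seq.
  by rewrite /walk_segment -(subnKC fm) iotaD map_cat count_cat leq_addr.
apply: (cvge_le _ (nondecreasing_cvg_mu mE _ _)).
- by apply: nearW => m; exact: visited_probability.
- exact: bigcup_measurable.
- by move=> m m' mm'; apply/subsetPset => w; apply: mono.
Qed.

End visits.

(** * Minimum over a finite set, and the two bounds *)

Lemma fset_min_gt0 (K : choiceType) (R : realType) (x0 : K) (L : {fset K})
    (f : K -> R) : L != fset0 -> (forall z, z \in L -> 0 < f z) ->
  0 < fset_min x0 L f.
Proof.
move=> L0 f_gt0; rewrite /fset_min big_seq; apply: lt_bigmin => //.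
(* The seed of the minimum is [f] at the head of [L], which belongs to [L] because [L] is nonempty;
   the default [x0] is not reached. *)
apply: f_gt0; case/fset0Pn: L0 => y; rewrite -[y \in L]/(y \in enum_fset L).
rewrite -[head x0 L \in L]/(head x0 L \in enum_fset L).
by case: (enum_fset L) => //= a s _; rewrite mem_head.
Qed.

Lemma fset_min_le (K : choiceType) (R : realType) (x0 : K) (L : {fset K})
    (f : K -> R) z : z \in L -> fset_min x0 L f <= f z.
Proof. by move=> zL; apply: ge_bigmin_seq. Qed.

Theorem theorem4p1 (R : realType) (d : nat) (hd : (3 <= d)%N)
    (disp : measure_display) (T : measurableType disp)
    (P : 'rV[int]_d -> probability T R)
    (S : nat -> {mfun T >-> 'rV[int]_d})
    (hS : forall x, simple_random_walk (P x) S x)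
    (L : {fset 'rV[int]_d}) (hL : L != fset0) :
  let q_ (z : 'rV[int]_d) : R := return_prob P S L z in
  let q : R := return_prob P S [fset 0]%fset 0 in
  (forall n : 'rV[int]_d -> nat,
    (P 0%R [set w | forall z, z \in L ->
            ((n z)%:R%:E <= local_time R S z w)%E]
     <= ((\prod_(z <- L) q_ z ^+ n z) / fset_min 0 L q_)%:E)%E) /\
  (forall t : R, 1 <= t ->
    (P 0%R [set w | forall z, z \in L -> (t%:E <= local_time R S z w)%E]
     <= (q^-1 * expR (- (t * capacity P S L)))%:E)%E).
Proof.
move=> q_ q; have d_gt0 : (0 < d)%N by exact: leq_trans hd.
have q_gt0 : 0 < q by exact: return_prob_gt0.
have q_le z : z \in L -> q <= q_ z.
  move=> zL; rewrite /q -(return_prob_shift hS z); apply: (sub_return_prob hS).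
  by move=> y; rewrite inE => /eqP ->.
split=> [n|t t1].
  apply: (local_times_probability hS _ _ (t := fun z => (n z)%:R)) => //.
  - by apply: fset_min_gt0 => // z /q_le; exact: lt_le_trans.
  - by move=> z; exact: fset_min_le.
  - by move=> z k; rewrite ler_nat.
have ceil_ge0 : 0 <= Num.ceil t by rewrite ceil_ge0 (lt_le_trans _ t1).
(* Local times count visits, so reaching the real level [t] means reaching its ceiling. *)
pose N := `|Num.ceil t|%N.
have NE : N%:Z = Num.ceil t by rewrite gez0_abs.
apply: (@le_trans _ _ (return_weight S P L q (fun=> N))%:E).
  apply: (local_times_probability hS _ _ (t := fun=> t)) => // _ k.
  by rewrite -[k%:R]/(k%:Z%:~R) -ceil_le_int -NE lez_nat.
rewrite lee_fin /return_weight mulrC ler_wpM2l ?invr_ge0 ?(ltW q_gt0)//.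
(* Returning from the ceiling to [t] only increases the exponential, as the capacity is
   nonnegative. *)
apply: (@le_trans _ _ (expR (- (N%:R * capacity P S L)))); last first.
  rewrite ler_expR lerN2 ler_wpM2r//.
    by apply: sumr_ge0 => z _; rewrite escape_probE subr_ge0 return_prob_le1.
  by rewrite -[N%:R]/(N%:Z%:~R) NE ceil_ge.
(* The capacity is a sum over [L], so the exponential factors over its points, and it suffices to
   compare each return probability with the exponential of minus the escape probability. *)
rewrite -mulrN /capacity -sumrN mulr_sumr expR_sum.
apply: ler_prod => z _; rewrite exprn_ge0 ?return_prob_ge0//= expRM_natl.
rewrite lerXn2r ?nnegrE ?return_prob_ge0 ?expR_ge0//.
by apply: le_trans (expR_ge1Dx _); rewrite escape_probE opprB addrC subrK.
Qed.
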